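(* Let $X$ be a Gromov hyperbolic geodesic metric space (not necessarily proper), and let $\partial_\infty X$ be its boundary, endowed with a visual metric. Then $$\ell\text{-}\dim(\partial_\infty X)\le \mathrm{asdim}(X).$$
   Context: A family $\mathcal U$ of subsets of a metric space $Z$ is $D$-bounded if every $U\in\mathcal U$ has diameter at most $D$; its $r$-multiplicity is the infimal integer $k$ such that every subset of $Z$ of diameter at most $r$ meets at most $k$ members of $\mathcal U$. $\mathrm{asdim}(Z)$ (asymptotic dimension) is the smallest $n\in\mathbb N\cup\{\infty\}$ such that for all $r>0$ there exist $D(r)<\infty$ and a $D(r)$-bounded cover of $Z$ with $r$-multiplicity at most $n+1$. $\ell\text{-}\dim(Z)$ (linearly controlled metric dimension, also called capacity dimension) is the smallest $n$ such that there exists $L<\infty$ with the property that for all sufficiently small $r>0$ there exists an $Lr$-bounded cover of $Z$ with $r$-multiplicity at most $n+1$. Boundary and visual metrics: fix a base point $0\in X$ and $\delta$ such that all geodesic triangles in $X$ are $\delta$-slim. $\partial_\infty X$ is the set of equivalence classes of $(1,20\delta)$-quasigeodesic rays $\gamma:[0,\infty)\to X$ with $\gamma(0)=0$, two rays being equivalent if they are at finite Hausdorff distance. Let $(x|y)=(x|y)_0$ be the Gromov product on $\partial_\infty X$ with respect to $0$; up to an additive error it equals the distance from $0$ to some (any) $(1,20\delta)$-quasigeodesic line from $x$ to $y$. A metric $\rho$ on $\partial_\infty X$ is a visual metric if there exist $C_0,\epsilon>0$ such that $\frac1{C_0}e^{-\epsilon(x|y)}\le\rho(x,y)\le C_0e^{-\epsilon(x|y)}$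 for all $x,y\in\partial_\infty X$. The value of $\ell\text{-}\dim(\partial_\infty X)$ does not depend on the choice of visual metric. *)

(* Defs.v *)
From HB Require Import structures.
From mathcomp Require Import all_boot all_order all_algebra.
From mathcomp Require Import all_classical all_reals all_analysis.

Set Implicit Arguments.
Unset Strict Implicit.
Unset Printing Implicit Defensive.

Import Order.TTheory GRing.Theory Num.Theory.
Import numFieldNormedType.Exports.

Local Open Scope classical_set_scope.
Local Open Scope card_scope.
Local Open Scope ring_scope.

Section dimensions.
Context {R : realType} {Z : metricType R}.
Implicit Types (A : set Z) (F : set (set Z)).

(* 0 is added so that the empty set has diameter 0 rather than -oo. *)
Definition diam A : \bar R :=
  ereal_sup (0%E |` [set (mdist x y)%:E | x in A & y in A]).

Definition bounded_family (D : R) F := forall U, F U -> (diam U <= D%:E)%E.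

Definition is_cover F := \bigcup_(U in F) U = [set: Z].

(* Infima over sets of natural numbers are taken in \bar R, so that the infimum
   of the empty set is +oo; otherwise they are minima. *)
Definition multiplicity (r : R) F : \bar R :=
  ereal_inf [set k%:R%:E | k in [set k : nat | forall A, (diam A <= r%:E)%E ->
    [set U | F U /\ U `&` A !=set0] #<= `I_k]].

End dimensions.

Definition asdim {R : realType} (Z : metricType R) : \bar R :=
  ereal_inf [set n%:R%:E | n in [set n : nat | forall r : R, 0 < r ->
    exists (D : R) (F : set (set Z)),
      [/\ is_cover F, bounded_family D F
        & (multiplicity r F <= n.+1%:R%:E)%E]]].

Definition ldim {R : realType} (Z : metricType R) : \bar R :=
  ereal_inf [set n%:R%:E | n in [set n : nat | exists L : R,
    \forall r \near (0 : R)^'+, exists F : set (set Z),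
      [/\ is_cover F, bounded_family (L * r) F
        & (multiplicity r F <= n.+1%:R%:E)%E]]].

Section geodesics.
Context {R : realType} {X : metricType R}.
Implicit Types (x y z o : X) (A B C : set X) (c : R -> X).

Definition geodesic_segment x y A := exists c,
  [/\ c 0 = x, c (mdist x y) = y,
      {in `[0, mdist x y] &, forall s t, mdist (c s) (c t) = `|s - t|}
    & A = c @` `[0, mdist x y]].

Definition thickening (r : R) A : set X :=
  [set x | exists2 a, A a & mdist x a <= r].

(* The condition on one side suffices, as the vertices range over all triples. *)
Definition slim_triangles (delta : R) := forall x y z A B C,
  geodesic_segment x y A -> geodesic_segment y z B -> geodesic_segment z x C ->
  A `<=` thickening delta (B `|` C).

Definition hausdorff_dist A B : \bar R :=
  ereal_inf [set r%:E | r in [set r : R |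
    [/\ 0 <= r, A `<=` thickening r B & B `<=` thickening r A]]].

Definition gromov_product o x y : R :=
  (mdist o x + mdist o y - mdist x y) / 2.

(* A ray is a map defined on R of which only the restriction to [0, +oo[ is
   relevant: maps that agree on [0, +oo[ are equivalent in [ray_equiv]. *)
Definition quasigeodesic_ray (lambda k : R) c :=
  {in `[0, +oo[ &, forall s t,
    lambda^-1 * `|s - t| - k <= mdist (c s) (c t) <= lambda * `|s - t| + k}.

Definition based_rays (delta : R) o : set (R -> X) :=
  [set c | c 0 = o /\ quasigeodesic_ray 1 (20 * delta) c].

Definition ray_equiv c c' :=
  hausdorff_dist (c @` `[0, +oo[) (c' @` `[0, +oo[) \is a fin_num.

End geodesics.

Definition geodesic_space {R : realType} (X : metricType R) :=
  forall x y : X, exists A, geodesic_segment x y A.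

Section boundary.
Context {R : realType} {X : metricType R}.
Variables (delta : R) (o : X).

Definition ray_class (c : R -> X) : set (R -> X) :=
  [set c' | based_rays delta o c' /\ ray_equiv c c'].

Definition boundary : set (set (R -> X)) := ray_class @` based_rays delta o.

(* sup over representatives c, c' of liminf_{s, t -> +oo} (c s | c' t)_o *)
Definition boundary_product (xi eta : boundary) : \bar R :=
  ereal_sup [set limf_einf
      (fun p : R * R => (gromov_product o (c p.1) (c' p.2))%:E)
      (filter_prod (pinfty_nbhs R) (pinfty_nbhs R))
    | c in val xi & c' in val eta].

Record visual_metric := VisualMetric {
  vdist :> boundary -> boundary -> R ;
  vdistxx : forall xi, vdist xi xi = 0 ;
  vdist_positivity : forall xi eta, vdist xi eta = 0 -> xi = eta ;
  vdist_sym : forall xi eta, vdist xi eta = vdist eta xi ;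
  vdist_triangle : forall eta xi zeta,
    vdist xi zeta <= vdist xi eta + vdist eta zeta ;
  vdist_visual : exists C0 eps : R, [/\ 0 < C0, 0 < eps & forall xi eta,
    (C0^-1%:E * expeR (- (eps%:E * boundary_product xi eta))
       <= (vdist xi eta)%:E
       <= C0%:E * expeR (- (eps%:E * boundary_product xi eta)))%E]
}.

Definition visual_boundary (rho : visual_metric) : Type := boundary.

Section instances.
Variable rho : visual_metric.

HB.instance Definition _ := Choice.on (visual_boundary rho).

HB.instance Definition _ := @isMetric.Build R (visual_boundary rho) rho
  (vdistxx rho) (@vdist_positivity rho) (vdist_sym rho) (vdist_triangle rho).

End instances.

Lemma visual_boundary_mdistE (rho : visual_metric) (xi eta : visual_boundary rho) :
  mdist xi eta = rho xi eta.
Proof. by []. Qed.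

End boundary.

(* Main.v *)
(* Send a boundary point xi to the point phi_r(xi) at time t = - ln r / eps of a
   ray representing it. By hyperbolicity, rho(xi, eta) <= r forces
   d(phi_r(xi), phi_r(eta)) <= K with K independent of r, and conversely
   d(phi_r(xi), phi_r(eta)) <= D forces rho(xi, eta) <= L r with L depending on
   D only. A D(K)-bounded cover of X with K-multiplicity at most n + 1 therefore
   pulls back along phi_r to an Lr-bounded cover of the boundary with
   r-multiplicity at most n + 1. *)
Require Import Defs.
From mathcomp Require Import all_boot all_order all_algebra.
From mathcomp Require Import all_classical all_reals all_analysis.
From mathcomp Require Import lra.

Set Implicit Arguments.
Unset Strict Implicit.
Unset Printing Implicit Defensive.

Local Open Scope ring_scope.

Import Order.TTheory GRing.Theory Num.Theory.
Import numFieldNormedType.Exports.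
Local Open Scope classical_set_scope.
Local Open Scope card_scope.

(** * Diameters, multiplicities and the transfer of covers *)

Section metric_families.
Context {R : realType} {Z : metricType R}.
Implicit Types (A : set Z) (F : set (set Z)).

Lemma mdist_le_diam A (D : R) (x y : Z) :
  (diam A <= D%:E)%E -> A x -> A y -> mdist x y <= D.
Proof.
move=> AD Ax Ay; rewrite -lee_fin; apply: le_trans AD.
by apply: ereal_sup_ubound; right; exists x => //; exists y.
Qed.

Lemma diam_le A (D : R) : 0 <= D ->
  (forall x y, A x -> A y -> mdist x y <= D) -> (diam A <= D%:E)%E.
Proof.
move=> D0 AD; apply: ge_ereal_sup => _ [->|[x Ax [y Ay <-]]]; rewrite lee_fin//.
exact: AD.
Qed.

Lemma multiplicity_leP (r : R) F n : (multiplicity r F <= n%:R%:E)%E <->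
  forall A, (diam A <= r%:E)%E -> [set U | F U /\ U `&` A !=set0] #<= `I_n.
Proof.
split=> [Fn|Fn]; last by apply: ereal_inf_lbound; exists n.
(* Relaxing to a strict bound by [n.+1] yields an admissible natural number [k < n.+1], hence
   [k <= n], without first showing that the infimum is attained. *)
have /ereal_inf_lt[_ [k Fk <-]] : (multiplicity r F < n.+1%:R%:E)%E.
  by apply: le_lt_trans Fn _; rewrite lte_fin ltr_nat.
rewrite lte_fin ltr_nat ltnS => kn A /Fk /card_le_trans; apply.
by rewrite card_le_II.
Qed.

End metric_families.

(** Isolates the covering argument from hyperbolicity, which enters later only to provide the two
    control hypotheses. *)
Lemma ldim_le_asdim (R : realType) (Z X : metricType R) (phi : R -> Z -> X)
    (K : R) : 0 < K ->
  (forall r z w, 0 < r < 1 -> mdist z w <= r ->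
    mdist (phi r z) (phi r w) <= K) ->
  (forall D, exists2 L, 0 <= L & forall r z w, 0 < r < 1 ->
    mdist (phi r z) (phi r w) <= D -> mdist z w <= L * r) ->
  (ldim Z <= asdim X)%E.
Proof.
move=> K0 phiK phiL; apply: ereal_inf_le_tmp.
apply: image_subset => n /= /(_ _ K0).
move=> [D [F [coverF boundF /multiplicity_leP multF]]].
(* The cover of [X], and with it [D], is fixed before [r], so one [L] serves all small [r]. *)
have [L L0 DL] := phiL D; exists L.
near=> r.
have r01 : 0 < r < 1.
  by apply/andP; split; near: r; [exact: nbhs_right_gt|exact: nbhs_right_lt].
exists [set phi r @^-1` U | U in F]; split.
- rewrite /is_cover -subTset => z _.
  have [U FU Uz] : (\bigcup_(U in F) U) (phi r z).
    by rewrite [\bigcup_(_ in _) _]coverF.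
  by exists (phi r @^-1` U) => //; exists U.
- move=> _ [U FU <-]; apply: diam_le => [|z w Uz Uw].
    (* An empty preimage has diameter 0, so [L * r] must be nonnegative. *)
    by case/andP: r01 => /ltW r0 _; rewrite mulr_ge0.
  by apply: DL => //; exact: (mdist_le_diam (boundF U FU)).
- apply/multiplicity_leP => A Ar.
  have phiA : (diam (phi r @` A) <= K%:E)%E.
    apply: diam_le => [|_ _ [z Az <-] [w Aw <-]]; first exact: ltW.
    by apply: phiK => //; apply: mdist_le_diam Az Aw.
  apply: card_le_trans (multF _ phiA).
  apply: card_le_trans (card_image_le (preimage (phi r)) _).
  apply: subset_card_le => _ [[U FU <-] [z [Uz Az]]].
  by exists U => //; split=> //; exists (phi r z); split=> //; exists z.
Unshelve. all: by end_near. Qed.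

(** * Gromov products in a space with slim triangles *)

Section hyperbolic.
Context {R : realType} {X : metricType R}.
Implicit Types (x y z o p : X) (A : set X).

Lemma gromov_productC o x y : gromov_product o x y = gromov_product o y x.
Proof. by rewrite /gromov_product (metric_sym x y); lra. Qed.

Lemma geodesic_segment_left x y A : geodesic_segment x y A -> A x.
Proof.
move=> [c [<- _ _ ->]]; exists 0 => //=.
by rewrite in_itv/= lexx mdist_ge0.
Qed.

Lemma geodesic_segment_right x y A : geodesic_segment x y A -> A y.
Proof.
move=> [c [_ cy _ ->]]; exists (mdist x y) => //=.
by rewrite in_itv/= lexx mdist_ge0.
Qed.

Lemma mdist_segment x y A p : geodesic_segment x y A -> A p ->
  mdist x p + mdist p y = mdist x y.
Proof.
move=> [c [c0 cl isoc ->]] [s /= sl <-].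
have := sl; rewrite in_itv/= => /andP[s0 sl'].
have l0 := mdist_ge0 x y.
have -> : mdist x (c s) = s.
  by rewrite -c0 isoc// ?in_itv/= ?lexx//; rewrite sub0r normrN ger0_norm.
have -> : mdist (c s) y = mdist x y - s.
  rewrite -{1}cl isoc// ?in_itv/= ?lexx ?andbT//.
  by rewrite distrC ger0_norm// subr_ge0.
by rewrite addrC subrK.
Qed.

Lemma gromov_product_le_mdist o x y A p : geodesic_segment x y A -> A p ->
  gromov_product o x y <= mdist o p.
Proof.
move=> xyA /(mdist_segment xyA); rewrite /gromov_product.
have := metric_triangle o p x; have := metric_triangle o p y.
by rewrite (metric_sym p x); lra.
Qed.

Context {delta : R}.
Hypotheses (geoX : geodesic_space X) (slimX : slim_triangles (X := X) delta).

(** In an empty space every real [delta] is slim; one point suffices, through its degenerate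
    triangle. *)
Lemma slim_ge0 : X -> 0 <= delta.
Proof.
move=> x; have [A xxA] := geoX x x.
have [a _] := slimX xxA xxA xxA (geodesic_segment_left xxA).
by apply: le_trans; exact: mdist_ge0.
Qed.

(* Moving along [x, y] from x, one leaves the neighbourhood of [o, x]: just
   before doing so, one is close to both [o, x] and [y, o]. *)
Lemma segment_near_gromov_product o x y A : geodesic_segment x y A ->
  exists2 p, A p & mdist o p <= gromov_product o x y + (2 * delta + 2).
Proof.
move=> xyA; have d0 := slim_ge0 o.
have [B yoB] := geoX y o; have [C oxC] := geoX o x.
have ABC := slimX xyA yoB oxC.
have Cx := geodesic_segment_right oxC.
have By := geodesic_segment_left yoB.
have [c [c0 cl isoc Ac]] := xyA; set l := mdist x y in cl isoc Ac *.
have l0 : 0 <= l by exact: mdist_ge0.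
pose S := [set s | 0 <= s <= l /\ thickening delta C (c s)].
have S0 : S 0.
  by split; [rewrite lexx|exists x; rewrite ?c0 ?mdistxx].
have supS : has_sup S.
  by split; [exists 0|exists l => s [/andP[]]].
(* [sup S] need not be attained: [s] is within 1 of it, and [u] is the smaller of [l] and
   [sup S + 1], whence the gap of at most 2. *)
have [s [/andP[s0 sl] [v Cv csv]] sS] := sup_adherent (@ltr01 R) supS.
have [u] : exists u, [/\ s <= u, u <= s + 2, 0 <= u <= l
    & thickening delta B (c u)].
  have sS' : s <= sup S.
    by apply: ub_le_sup; [case: supS|split; [rewrite s0|exists v]].
  have [lS|Sl] := leP l (sup S + 1).
    exists l; split=> //; [lra|by rewrite l0/=|exists y => //].
    by rewrite cl mdistxx.
  exists (sup S + 1); split; [lra|lra|by apply/andP; split; lra|].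
  have [|w [Bw|Cw] cw] := ABC (c (sup S + 1)).
  - rewrite Ac; exists (sup S + 1) => //=; rewrite in_itv/=.
    by apply/andP; split; lra.
  - by exists w.
  - have : S (sup S + 1) by split; [apply/andP; split; lra|exists w].
    by move/(ub_le_sup supS.2); lra.
move=> [su us /andP[u0 ul] [w Bw cuw]].
have Acs : A (c s) by rewrite Ac; exists s => //=; rewrite in_itv/= s0 sl.
exists (c s) => //.
have csu : mdist (c s) (c u) <= 2.
  rewrite isoc ?in_itv/= ?s0 ?sl ?u0 ?ul//.
  by rewrite distrC ger0_norm; lra.
(* Detours through [c s] cost at most [2 * delta] on [o, x] and [2 * delta + 4] on [y, o]; half of
   their sum is the error term. *)
have := mdist_segment oxC Cv; have := mdist_segment yoB Bw.
have := mdist_segment xyA Acs.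
rewrite /gromov_product.
have := metric_triangle o v (c s); have := metric_triangle x v (c s).
have := metric_triangle o w (c u); have := metric_triangle y w (c u).
have := metric_triangle o (c u) (c s); have := metric_triangle y (c u) (c s).
rewrite (metric_sym v (c s)) (metric_sym w (c u)) (metric_sym (c u) (c s)).
rewrite (metric_sym y o) (metric_sym w o) (metric_sym v x).
by rewrite (metric_sym (c s) y); lra.
Qed.

(** A point of [x, z] nearly realizing the product is [delta]-close to [x, y] or [y, z], and points
    there are at distance at least [m] from [o]. *)
Lemma gromov_product_four_point m o x y z :
  m <= gromov_product o x y -> m <= gromov_product o y z ->
  m - (3 * delta + 2) <= gromov_product o x z.
Proof.
move=> mxy myz; have [A xzA] := geoX x z.
have [p Ap op] := segment_near_gromov_product o xzA.
have [B zyB] := geoX z y; have [C yxC] := geoX y x.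
have [q BCq pq] := slimX xzA zyB yxC Ap.
suff : m <= mdist o q.
  by have := metric_triangle o p q; lra.
case: BCq => [Bq|Cq].
  rewrite gromov_productC in myz.
  exact: le_trans myz (gromov_product_le_mdist o zyB Bq).
rewrite gromov_productC in mxy.
exact: le_trans mxy (gromov_product_le_mdist o yxC Cq).
Qed.

Lemma gromov_product_five_point m o x y z t :
  m <= gromov_product o x y -> m <= gromov_product o y z ->
  m <= gromov_product o z t ->
  m - (6 * delta + 4) <= gromov_product o x t.
Proof.
move=> mxy myz mzt; have d0 := slim_ge0 o.
have xz := gromov_product_four_point mxy myz.
have zt : m - (3 * delta + 2) <= gromov_product o z t by lra.
by have := gromov_product_four_point xz zt; lra.
Qed.

End hyperbolic.

(** * Quasigeodesic rays and their classes at infinity *)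

Section rays.
Context {R : realType} {X : metricType R} {delta : R} {o : X}.
Hypotheses (geoX : geodesic_space X) (slimX : slim_triangles (X := X) delta).
Implicit Types (c : R -> X) (xi eta : boundary delta o).

Lemma mdist_ray c s t : based_rays delta o c -> 0 <= s -> s <= t ->
  t - s - 20 * delta <= mdist (c s) (c t) <= t - s + 20 * delta.
Proof.
move=> [_ qc] s0 st; have := qc s t.
rewrite !in_itv/= !andbT s0 (le_trans s0 st).
by move=> /(_ isT isT); rewrite invr1 !mul1r distrC ger0_norm// subr_ge0.
Qed.

Lemma mdist_ray0 c t : based_rays delta o c -> 0 <= t ->
  t - 20 * delta <= mdist o (c t) <= t + 20 * delta.
Proof.
move=> [c0 qc] t0; have := mdist_ray (conj c0 qc) (lexx 0) t0.
by rewrite c0 subr0.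
Qed.

Lemma gromov_product_ray c t s : based_rays delta o c -> 0 <= t -> t <= s ->
  t - 30 * delta <= gromov_product o (c t) (c s).
Proof.
move=> cray t0 ts; have := mdist_ray cray t0 ts; have := mdist_ray0 cray t0.
have := mdist_ray0 cray (le_trans t0 ts).
by rewrite /gromov_product => /andP[? ?] /andP[? ?] /andP[? ?]; lra.
Qed.

(** The five-point inequality along [c t], [c s], [c' s'], [c' t] bounds the product of the two
    time-[t] points from below; these are at distance about [t] from [o], so they are close. *)
Lemma fellow_travel c c' t s s' a : based_rays delta o c ->
  based_rays delta o c' -> 0 <= t -> t <= s -> t <= s' -> 0 <= a ->
  t - a <= gromov_product o (c s) (c' s') ->
  mdist (c t) (c' t) <= 112 * delta + 8 + 2 * a.
Proof.
move=> cray c'ray t0 ts ts' a0 ccs; have d0 := slim_ge0 geoX slimX o.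
have cts := gromov_product_ray cray t0 ts.
have c'ts := gromov_product_ray c'ray t0 ts'.
pose m := t - a - 30 * delta.
have h1 : m <= gromov_product o (c t) (c s) by rewrite /m; lra.
have h2 : m <= gromov_product o (c s) (c' s') by rewrite /m; lra.
have h3 : m <= gromov_product o (c' s') (c' t).
  by rewrite /m gromov_productC; lra.
have := gromov_product_five_point geoX slimX h1 h2 h3.
have /andP[_ ?] := mdist_ray0 cray t0; have /andP[_ ?] := mdist_ray0 c'ray t0.
by rewrite /m /gromov_product; lra.
Qed.

(** Converse of [fellow_travel], with the chain [c s], [c t], [c' t], [c' s']. *)
Lemma gromov_product_fellow c c' t s s' D : based_rays delta o c ->
  based_rays delta o c' -> 0 <= t -> t <= s -> t <= s' ->
  mdist (c t) (c' t) <= D ->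
  t - (36 * delta + 4 + D / 2) <= gromov_product o (c s) (c' s').
Proof.
move=> cray c'ray t0 ts ts' ctD; have d0 := slim_ge0 geoX slimX o.
have cts := gromov_product_ray cray t0 ts.
have c'ts := gromov_product_ray c'ray t0 ts'.
have /andP[? _] := mdist_ray0 cray t0; have /andP[? _] := mdist_ray0 c'ray t0.
have D0 := le_trans (mdist_ge0 _ _) ctD.
pose m := t - 30 * delta - D / 2.
have h1 : m <= gromov_product o (c s) (c t) by rewrite /m gromov_productC; lra.
have h2 : m <= gromov_product o (c t) (c' t).
  by rewrite /m /gromov_product; lra.
have h3 : m <= gromov_product o (c' t) (c' s') by rewrite /m; lra.
by have := gromov_product_five_point geoX slimX h1 h2 h3; rewrite /m; lra.
Qed.

Lemma ray_equiv_refl c : ray_equiv c c.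
Proof.
rewrite /ray_equiv.
suff -> : hausdorff_dist (c @` `[0, +oo[) (c @` `[0, +oo[) = 0%E by [].
apply/eqP; rewrite eq_le; apply/andP; split.
  apply: ereal_inf_lbound; exists 0 => //; split => //.
    by move=> x cx; exists x; rewrite ?mdistxx.
  by move=> x cx; exists x; rewrite ?mdistxx.
by apply: le_ereal_inf_tmp => _ [r [r0 _ _] <-]; rewrite lee_fin.
Qed.

Lemma equiv_rays_fellow c c' t : based_rays delta o c ->
  based_rays delta o c' -> ray_equiv c c' -> 0 <= t ->
  mdist (c t) (c' t) <= 112 * delta + 8.
Proof.
move=> cray c'ray cc' t0; have d0 := slim_ge0 geoX slimX o.
move: cc'; rewrite /ray_equiv fin_numE -ltey.
move=> /andP[_ /ereal_inf_lt[_ [H [H0 ccH _] _] _]].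
(* So far out, a point [c' s'] within [H] of [c s] still has [s' >= t], and their product is at
   least [t]; thus [H] drops out of the final bound. *)
have [s sE] : exists s, s = t + H + 60 * delta by eexists.
have s0 : 0 <= s by lra.
have [|_ [s' /= s'0 <-] ss'] := ccH (c s).
  by exists s => //=; rewrite in_itv/= s0.
have {}s'0 : 0 <= s' by move: s'0; rewrite in_itv/= andbT.
have /andP[? ?] := mdist_ray0 cray s0; have /andP[? ?] := mdist_ray0 c'ray s'0.
have := metric_triangle o (c' s') (c s); rewrite (metric_sym (c' s')) => tri.
have ts' : t <= s' by lra.
have := @fellow_travel c c' t s s' 0 cray c'ray t0 _ ts' (lexx 0).
rewrite mulr0 addr0; apply; first by lra.
by rewrite /gromov_product; lra.
Qed.

Lemma boundary_has_ray xi : exists c, [/\ based_rays delta o c, val xi c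
  & forall c', val xi c' -> based_rays delta o c' /\ ray_equiv c c'].
Proof.
have /set_mem[c cray cxi] := valP xi.
exists c; split=> //; last by move=> c'; rewrite -cxi.
by rewrite -cxi; split=> //; exact: ray_equiv_refl.
Qed.

Definition boundary_ray xi := projT1 (cid (boundary_has_ray xi)).

Lemma boundary_rayP xi : [/\ based_rays delta o (boundary_ray xi),
    val xi (boundary_ray xi)
  & forall c, val xi c ->
      based_rays delta o c /\ ray_equiv (boundary_ray xi) c].
Proof. by rewrite /boundary_ray; case: cid. Qed.

(** The supremum and the liminf select representatives [c], [c'] other than the chosen rays.
    Changing representative twice and travelling from [c] to [c'] costs [112 * delta + 8] each time,
    plus [2 * a]. *)
Lemma boundary_product_fellow xi eta t a : 0 <= t -> 0 <= a ->
  ((t - a)%:E < boundary_product xi eta)%E ->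
  mdist (boundary_ray xi t) (boundary_ray eta t) <= 336 * delta + 24 + 2 * a.
Proof.
move=> t0 a0 /ereal_sup_gt[_ [c xic [c' etac' <-]]].
rewrite limf_einfE => /ereal_sup_gt[_ [V [[P Q] /= [Poo Qoo] PQV] <-]] infV.
have [ray_xi _ /(_ _ xic)[cray xi_c]] := boundary_rayP xi.
have [ray_eta _ /(_ _ etac')[c'ray eta_c']] := boundary_rayP eta.
have [s [ts Ps]] : exists s, t <= s /\ P s.
  near +oo_R => s; exists s; split; last by near: s.
  by near: s; apply: nbhs_pinfty_ge; exact: num_real.
have [s' [ts' Qs']] : exists s, t <= s /\ Q s.
  near +oo_R => s'; exists s'; split; last by near: s'.
  by near: s'; apply: nbhs_pinfty_ge; exact: num_real.
have ccs : t - a <= gromov_product o (c s) (c' s').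
  rewrite -lee_fin; apply: le_trans (ltW infV) _.
  by apply: ereal_inf_lbound; exists (s, s') => //; exact: PQV.
have := fellow_travel cray c'ray t0 ts ts' a0 ccs.
have := equiv_rays_fellow ray_xi cray xi_c t0.
have := equiv_rays_fellow ray_eta c'ray eta_c' t0.
have := metric_triangle (boundary_ray xi t) (c t) (boundary_ray eta t).
have := metric_triangle (c t) (c' t) (boundary_ray eta t).
by rewrite (metric_sym (c' t) (boundary_ray eta t)); lra.
Unshelve. all: by end_near. Qed.

Lemma fellow_boundary_product xi eta t D : 0 <= t ->
  mdist (boundary_ray xi t) (boundary_ray eta t) <= D ->
  ((t - (36 * delta + 4 + D / 2))%:E <= boundary_product xi eta)%E.
Proof.
move=> t0 xetaD; have [ray_xi xi_rep _] := boundary_rayP xi.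
have [ray_eta eta_rep _] := boundary_rayP eta.
apply: le_ereal_sup_tmp; eexists.
  by exists (boundary_ray xi) => //; exists (boundary_ray eta).
rewrite limf_einfE; apply: le_ereal_sup_tmp; eexists.
  (* [gromov_product_fellow] is uniform in [s] and [s'] beyond [t], so this tail bounds the
     liminf. *)
  exists ([set s | t <= s] `*` [set s | t <= s]) => //.
  by exists ([set s | t <= s], [set s | t <= s]) => //; split;
     apply: nbhs_pinfty_ge; exact: num_real.
apply: le_ereal_inf_tmp => _ [[s s'] /= [ts ts'] <-]; rewrite lee_fin.
exact: gromov_product_fellow.
Qed.

End rays.

(** * Comparison of a visual metric with rays at a fixed time *)

Theorem proposition3p6 (R : realType) (X : metricType R) (delta : R) (o : X)
    (geoX : geodesic_space X) (slimX : slim_triangles (X := X) delta)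
    (rho : visual_metric delta o) :
  (ldim (visual_boundary rho) <= asdim X)%E.
Proof.
have d0 := slim_ge0 geoX slimX o.
have [C0 [eps [C00 eps0 rhoP]]] := vdist_visual rho.
pose t r := - (ln r) / eps.
have epst r : - (eps * t r) = ln r.
  by rewrite /t mulrC divfK ?opprK// gt_eqF.
have t0 r : 0 < r < 1 -> 0 <= t r.
  by move=> /andP[r0 r1]; rewrite divr_ge0 ?oppr_ge0 ?ln_le0// ltW.
(* Chosen so that [expR (eps * a) = expR (C0 + 1) > C0]: a product at most [t r - a] would then
   force [rho xi eta > r]. *)
pose a := (C0 + 1) / eps.
have a0 : 0 <= a by rewrite divr_ge0// ltW// ltr_wpDl// ltW.
apply: (@ldim_le_asdim R (visual_boundary rho) X
  (fun r xi => boundary_ray xi (t r)) (336 * delta + 24 + 2 * a))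
  => [|r xi eta r01 xer|D].
- lra.
- apply: boundary_product_fellow => //; first exact: t0.
  case/andP: (r01) => r0 _.
  rewrite ltNge; apply/negP => bpta.
  have /andP[+ _] := rhoP xi eta.
  rewrite leNgt => /negP; apply.
  have : ((rho xi eta)%:E <= r%:E)%E by rewrite lee_fin.
  move=> /le_lt_trans; apply.
  have : ((r * expR (C0 + 1))%:E <=
      expeR (- (eps%:E * boundary_product xi eta)))%E.
    have -> : r * expR (C0 + 1) = expR (- (eps * (t r - a))).
      rewrite mulrBr opprB [RHS]expRD epst lnK// /a mulrC (mulrC eps) divfK//.
      by rewrite gt_eqF.
    rewrite -[leLHS]/(expeR (- (eps * (t r - a)))%:E) lee_expeR.
    by rewrite EFinN leeN2 EFinM lee_pmul2l// lte_fin.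
  rewrite -(@lee_pmul2l _ C0^-1%:E) ?lte_fin ?invr_gt0//; apply: lt_le_trans.
  rewrite -EFinM lte_fin mulrCA ltr_pMr// ltr_pdivlMl// mulr1.
  by apply: lt_le_trans (expR_ge1Dx _); lra.
(* The product is at least [t r - M], with [M] the bracket here, and [expR (- (eps * t r)) = r]. *)
- exists (C0 * expR (eps * (36 * delta + 4 + D / 2))).
    by rewrite mulr_ge0 ?expR_ge0// ltW.
  move=> r xi eta r01 /(fellow_boundary_product geoX slimX (t0 _ r01)) bp.
  case/andP: (r01) => r0 _.
  have /andP[_] := rhoP xi eta; rewrite -lee_fin => /le_trans; apply.
  rewrite -mulrA EFinM lee_pmul2l// ?lte_fin//.
  set M := 36 * _ + _ + _ in bp *.
  have -> : expR (eps * M) * r = expR (- (eps * (t r - M))).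
    by rewrite mulrBr opprB expRD epst lnK.
  (* Comparing extended exponentials also covers [xi = eta], where the product is infinite. *)
  rewrite -[leRHS]/(expeR (- (eps * (t r - M)))%:E) lee_expeR.
  by rewrite EFinN leeN2 EFinM lee_pmul2l// lte_fin.
Qed.
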